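(* Let $A_1A_2A_3A_4$ be a complete quadrangle in the extended Euclidean plane, and let $i,j,k,s$ be pairwise different elements of $\{1,2,3,4\}$ (so $\{i,j,k,s\}=\{1,2,3,4\}$). Let $U_{js}\in A_jA_s$ and $U_{ik}\in A_iA_k$ be arbitrarily chosen points (each may be finite or infinite). Put $g=U_{js}U_{ik}$, $I=A_iA_k\cap A_jA_s$, $M=A_iU_{js}\cap A_jA_k$, $N=A_jU_{ik}\cap A_iA_s$ and $J=A_iM\cap A_jN$, where it is understood that all the lines and intersection points named here and below are well defined (two points that are joined are distinct, two lines that are intersected are distinct). Then: 1) the lines $g$, $MN$, $A_kA_s$ are concurrent; 2) the lines $A_sM$, $A_kN$, $IJ$ are concurrent.
   Context: The ambient plane is the extended Euclidean plane, i.e. the Euclidean plane complemented with its points at infinity and its line at infinity $\omega$ (a model of the real projective plane). For distinct points $X,Y$, $XY$ denotes the line joining them, and for distinct lines $a,b$, $a\cap b$ denotes their intersection point. A complete quadrangle $A_1A_2A_3A_4$ is a set of four points, no three collinear, together with the six lines $A_pA_q$ ($p\neq q$) joining them. Lines are concurrent if they pass through a common point (possibly at infinity). *)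

(* Defs.v *)
(* Libraries: MathComp and MathComp-Analysis. *)
From HB Require Import structures.
From mathcomp Require Import all_boot all_order all_algebra.
From mathcomp Require Import boolp classical_sets reals.

Set Implicit Arguments.
Unset Strict Implicit.
Unset Printing Implicit Defensive.

Import Order.TTheory GRing.Theory Num.Theory.
Local Open Scope classical_set_scope.
Local Open Scope ring_scope.

Section ExtendedPlane.
Variable R : realType.

(* A class of parallel lines of R^2 is identified with the common direction of
   its lines, a one-dimensional subspace of R^2. *)
Definition direction := {D : {vspace 'rV[R]_2} | \dim D == 1%N}.

Inductive epoint :=
  | Finite of 'rV[R]_2
  | AtInfinity of direction.

HB.instance Definition _ := gen_eqMixin epoint.
HB.instance Definition _ := gen_choiceMixin epoint.

(* The affine line p + D together with its point at infinity. *)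
Definition affine_line (p : 'rV[R]_2) (D : direction) : set epoint :=
  fun X => match X with
           | Finite q => q - p \in val D
           | AtInfinity E => E = D
           end.

Definition omega : set epoint := range AtInfinity.

Definition is_line (L : set epoint) : Prop :=
  L = omega \/ exists p D, L = affine_line p D.

(* The line XY; only meaningful for X <> Y, see join_spec. *)
Definition join (X Y : epoint) : set epoint :=
  xget omega [set L | [/\ is_line L, L X & L Y]].

(* The point of intersection of a and b; only meaningful for distinct lines,
   see meet_spec. *)
Definition meet (a b : set epoint) : epoint :=
  xget (Finite 0) (a `&` b).

Definition collinear (X Y Z : epoint) : Prop :=
  exists L, [/\ is_line L, L X, L Y & L Z].

Definition concurrent (a b c : set epoint) : Prop :=
  exists X, [/\ a X, b X & c X].

Definition complete_quadrangle (A : 'I_4 -> epoint) : Prop :=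
  injective A /\
  forall p q r : 'I_4, uniq [:: p; q; r] -> ~ collinear (A p) (A q) (A r).

Lemma dim_line (v : 'rV[R]_2) : v != 0 -> \dim <[v]> == 1%N.
Proof. by move=> v0; rewrite dim_vline v0. Qed.

Definition direction_of (v : 'rV[R]_2) (v0 : v != 0) : direction :=
  exist _ <[v]>%VS (dim_line v0).

Lemma direction_eq (D : direction) (v : 'rV[R]_2) (v0 : v != 0) :
  v \in val D -> D = direction_of v0.
Proof.
move=> vD; apply/val_inj => /=; apply/esym/eqP.
by rewrite eqEdim -memvE vD /= dim_vline v0 (eqP (valP D)).
Qed.

Lemma affine_line_eq (p q : 'rV[R]_2) (D : direction) :
  q - p \in val D -> affine_line p D = affine_line q D.
Proof.
move=> qp; apply/funext => -[r|E] //=; congr is_true.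
by rewrite -(subrKA q) rpredDr.
Qed.

Lemma join_ex (X Y : epoint) : X <> Y ->
  exists L, [/\ is_line L, L X & L Y].
Proof.
case: X Y => [p|D] [q|E] XY.
- have qp0 : q - p != 0 by rewrite subr_eq0; apply/eqP => pq; apply: XY; rewrite pq.
  exists (affine_line p (direction_of qp0)).
  by split=> /=; [right; do 2 eexists | rewrite subrr mem0v | rewrite memv_line].
- exists (affine_line p E).
  by split=> //=; [right; do 2 eexists | rewrite subrr mem0v].
- exists (affine_line q D).
  by split=> //=; [right; do 2 eexists | rewrite subrr mem0v].
- by exists omega; split; [left | exists D | exists E].
Qed.

Lemma join_uniq (X Y : epoint) (L L' : set epoint) : X <> Y ->
  is_line L -> L X -> L Y -> is_line L' -> L' X -> L' Y -> L = L'.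
Proof.
have oF x : ~ omega (Finite x) by case.
move=> XY [->|[p [F ->]]] LX LY [->|[q [G ->]]] L'X L'Y //.
- case: X Y XY LX LY L'X L'Y => [x|D] [y|E] XY LX LY //=; try by [case: (oF _ LX)|case: (oF _ LY)].
  by move=> DG EG; case: XY; rewrite DG EG.
- case: X Y XY LX LY L'X L'Y => [x|D] [y|E] XY //= DF EF; try by [move=> /oF|move=> _ /oF].
  by case: XY; rewrite DF EF.
case: X Y XY LX LY L'X L'Y => [x|D] [y|E] XY /= LX LY L'X L'Y.
- have v0 : y - x != 0.
    by rewrite subr_eq0; apply/eqP => yx; apply: XY; rewrite yx.
  have vF : y - x \in val F by rewrite -(subrKA p) addrC rpredD // -opprB rpredN.
  have vG : y - x \in val G by rewrite -(subrKA q) addrC rpredD // -opprB rpredN.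
  rewrite (affine_line_eq LX) (affine_line_eq L'X).
  by rewrite (direction_eq v0 vF) (direction_eq v0 vG).
- by rewrite (affine_line_eq LX) (affine_line_eq L'X) -LY L'Y.
- by rewrite (affine_line_eq LY) (affine_line_eq L'Y) -LX L'X.
- by case: XY; rewrite LX LY.
Qed.

Lemma join_spec (X Y : epoint) : X <> Y ->
  [/\ is_line (join X Y), join X Y X, join X Y Y &
      forall L, is_line L -> L X -> L Y -> L = join X Y].
Proof.
move=> XY.
have [lL LX LY] := xgetPex omega (join_ex XY).
by split=> // L lL' L'X L'Y; exact: (join_uniq XY).
Qed.

Lemma direction_sum (D E : direction) : D <> E -> (val D + val E = fullv)%VS.
Proof.
move=> DE; apply/eqP; rewrite eqEdim subvf /= dimvf /dim /= mul1n.
have := dimv_sum_cap (val D) (val E); rewrite (eqP (valP D)) (eqP (valP E)).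
suff -> : \dim (val D :&: val E) = 0%N by rewrite addn0 => ->.
apply/eqP; rewrite dimv_eq0; apply: contrapT => /negP; rewrite -vpick0 => cap0.
have := memv_pick (val D :&: val E)%VS; rewrite memv_cap => /andP[vD vE].
by apply: DE; rewrite (direction_eq cap0 vD); exact/esym/direction_eq.
Qed.

Lemma meet_ex (a b : set epoint) : is_line a -> is_line b -> a <> b ->
  exists X, (a `&` b) X.
Proof.
move=> [->|[p [D ->]]] [->|[q [E ->]]] // ab.
- by exists (AtInfinity E); split=> //; exists E.
- by exists (AtInfinity D); split=> //; exists D.
have [DE|DE] := pselect (D = E).
  by exists (AtInfinity D); split.
have : q - p \in (val D + val E)%VS by rewrite (direction_sum DE) memvf.
case/memv_addP => d dD [e eE qp]; exists (Finite (p + d)); split => /=.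
  by rewrite addrC addKr.
by rewrite -opprB rpredN opprD addrA qp [d + e]addrC addrK.
Qed.

Lemma meet_spec (a b : set epoint) : is_line a -> is_line b -> a <> b ->
  [/\ a (meet a b), b (meet a b) & forall X, a X -> b X -> X = meet a b].
Proof.
move=> la lb ab; have [am bm] := xgetPex (Finite 0) (meet_ex la lb ab).
split=> // X aX bX; apply: contrapT => Xm.
by apply: ab; exact: (join_uniq Xm).
Qed.

End ExtendedPlane.

(* Main.v *)
Require Import Defs.
From mathcomp Require Import all_boot all_order all_algebra.
From mathcomp Require Import boolp classical_sets reals.
From mathcomp Require Import ring.

Set Implicit Arguments.
Unset Strict Implicit.
Unset Printing Implicit Defensive.

Import GRing.Theory.
Local Open Scope ring_scope.

(** Both statements are incidences between linear combinations of four vectors,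
    so the proof is a computation in homogeneous coordinates, carried out without
    any coordinates of the individual points.

    A finite point p is represented by the nonzero multiples of (p, 1), and a
    point at infinity by the vectors (d, 0) with d nonzero in its direction; Z
    lies on XY exactly when a vector of Z is a linear combination of vectors of X and Y
    (joinP). The diagonal point I lies on A_i A_k and on A_j A_s, so scaling the
    four vertex vectors gives e_s = e_i + e_j + e_k with I = e_i + e_k
    (quadrangle_frame). Write U_js = u = a e_j + b e_s and
    U_ik = v = c e_i + d e_k. Then
      - M = m = (a + b) e_j + b e_k = u - b e_i,
      - N = n = c e_i + d e_j + d e_k = v + d e_j = (c - d) e_i + d e_s,
      - J = bc e_i + (a + b) d e_j + bd e_k = bc e_i + d m = ad e_j + b n,
    and the points of concurrency are
      - c u + a v = (c - d) m + (a + b) n = (ad - ac) e_k + (ac + bc) e_s,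
        on g, MN and A_k A_s;
      - c (a + b) e_s + (d - c) m = a (c - d) e_k + (a + b) n
        = ca (e_i + e_k) + J, on A_s M, A_k N and IJ.
    Every special position of U_js and U_ik is covered by the same formulas: it
    only remains to see that these vectors are nonzero. If one vanishes, its
    expressions by vectors of distinct points have zero coefficients
    (represents_colinear), which forces a coincidence that the hypotheses
    exclude. *)

(* The equality is checked on each coordinate; abstracting the last coordinates
   turns them from elements of R^o into elements of R. *)
Ltac vect_ring :=
  apply: injective_projections => /=;
  [ apply/rowP => ?; rewrite !mxE
  | rewrite /GRing.scale /=;
    repeat match goal with
           | |- context [@snd ?S ?T ?w] => move: (@snd S T w)
           end;
    rewrite /GRing.regular; intros ]; ring.

Section HomogeneousCoordinates.
Variable R : realType.

(** The second component is in R^o so that the product is an R-module. *)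
Definition hvect := ('rV[R]_2 * R^o)%type.

Definition represents (w : hvect) (X : epoint R) : Prop :=
  match X with
  | Defs.Finite p => w.2 != 0 /\ w.1 = (w.2 : R) *: p
  | AtInfinity D => [/\ w.2 = 0, w.1 != 0 & w.1 \in val D]
  end.

Lemma represents_ex (X : epoint R) : exists w, represents w X.
Proof.
case: X => [p|D].
  by exists (p, 1); split; rewrite /= ?oner_eq0 ?scale1r.
exists (vpick (val D), 0); split=> //=; last exact: memv_pick.
by rewrite vpick0 -dimv_eq0 (eqP (valP D)).
Qed.

Lemma point_ex (w : hvect) : w <> 0 -> exists X, represents w X.
Proof.
case: w => q z wn0; have [z0|zn0] := eqVneq z 0.
  have qn0 : q != 0 by apply/eqP => q0; apply: wn0; rewrite q0 z0.
  by exists (AtInfinity (direction_of qn0)); split; rewrite ?memv_line.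
exists (Defs.Finite (z^-1 *: q)); split=> //=.
by rewrite scalerA divff // scale1r.
Qed.

Lemma represents_neq0 (w : hvect) X : represents w X -> w <> 0.
Proof.
by case: X => [p [+ _]|D [_ + _]] w0; rewrite w0 /= eqxx.
Qed.

Lemma representsZ (w : hvect) X c :
  c <> 0 -> represents w X -> represents (c *: w) X.
Proof.
move=> /eqP c0; case: X => [p [w2 w1]|D [w2 w1 wD]] /=.
  by split; rewrite ?mulf_neq0 // w1 scalerA.
by split; rewrite ?w2 ?scaler0 ?scaler_eq0 ?negb_or ?c0 ?memvZ.
Qed.

Lemma represents_inj (w : hvect) X Y :
  represents w X -> represents w Y -> X = Y.
Proof.
case: X Y => [p|D] [q|E] //=.
- by move=> [w2 ->] [_ /(scalerI w2) ->].
- by move=> [/eqP w2 _] [/w2].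
- by move=> [w2 _ _] [/eqP /(_ w2)].
- by move=> [_ w1 wD] [_ _ wE]; rewrite (direction_eq w1 wD) -(direction_eq w1 wE).
Qed.

(** Proportional vectors represent the same point, so vectors of distinct points
    are linearly independent. *)
Lemma represents_colinear (u v : hvect) X Y a b :
  represents u X -> represents v Y -> X <> Y ->
  a *: u + b *: v = 0 -> a = 0 /\ b = 0.
Proof.
move=> uX vY XY uv0.
have un0 := represents_neq0 uX; have vn0 := represents_neq0 vY.
have [a0|/eqP an0] := eqVneq a 0.
  split=> //; move/eqP: uv0; rewrite a0 scale0r add0r scaler_eq0.
  by case/orP => /eqP.
have [b0|/eqP bn0] := eqVneq b 0.
  by move/eqP: uv0; rewrite b0 scale0r addr0 scaler_eq0 => /orP[]/eqP.
case: XY; apply: (represents_inj (representsZ an0 uX)).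
have -> : a *: u = (- b) *: v by apply/eqP; rewrite scaleNr -addr_eq0 uv0.
by apply: representsZ vY => /eqP; rewrite oppr_eq0 => /eqP.
Qed.

(** A line is a plane through the origin of the space of vectors: omega is
    spanned by the vectors (e, 0), and p + D by (p, 1) and (e, 0) with e a basis of D. *)
Lemma line_plane (L : set (epoint R)) : is_line L ->
  exists e f : hvect, forall w X, represents w X ->
    (L X <-> exists a b, w = a *: e + b *: f).
Proof.
case=> [->|[p [D ->]]].
  exists (delta_mx 0 0, 0), (delta_mx 0 1, 0) => w [q|E] wX.
    split=> [[]//|[a [b wab]]].
    by case: wX => /eqP[]; rewrite wab /= !scaler0 addr0.
  split=> [_|_]; last by exists E.
  case: wX => w2 _ _; exists (w.1 0 0), (w.1 0 1).
  apply: injective_projections => /=; last by rewrite w2 !scaler0 addr0.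
  by apply/rowP => i; rewrite !mxE; case: i => -[|[|//]] h /=;
    rewrite ?mulr1 ?mulr0 ?addr0 ?add0r; congr (w.1 _ _); apply/val_inj.
set e := vpick (val D).
have en0 : e != 0 by rewrite vpick0 -dimv_eq0 (eqP (valP D)).
have De : val D = <[e]>%VS by rewrite (direction_eq en0 (memv_pick _)).
exists (p, 1), (e, 0) => w [q|E].
  case=> w2 w1; rewrite /affine_line De; split=> [/vlineP[t qp]|[a [b wab]]].
    exists w.2, (w.2 * t); apply: injective_projections => /=.
      by rewrite w1 -scalerA -qp scalerBr addrC subrK.
    by rewrite scaler0 addr0 /GRing.scale /= mulr1.
  have aw : w.2 = a.
    by rewrite wab /= scaler0 addr0 /GRing.scale /= mulr1.
  apply/vlineP; exists (w.2^-1 * b).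
  apply: (scalerI w2); rewrite scalerBr -w1 scalerA mulrA divff // mul1r.
  by rewrite {1}wab /= aw addrAC subrr add0r.
case=> w2 w1 wE /=; split=> [ED|[a [b wab]]].
  move: wE; rewrite ED De => /vlineP[t wt]; exists 0, t.
  apply: injective_projections => /=; first by rewrite scale0r add0r.
  by rewrite w2 scale0r add0r scaler0.
have a0 : a = 0 by rewrite -w2 wab /= scaler0 addr0 /GRing.scale /= mulr1.
have wD : w.1 \in val D.
  by rewrite De wab /= a0 scale0r add0r memvZ // memv_line.
by rewrite (direction_eq w1 wE) -(direction_eq w1 wD).
Qed.

(** Within the plane of the line XY, the independent vectors u and v form a
    basis; the coefficients of w are given by Cramer's rule. *)
Lemma joinP (u v w : hvect) X Y Z : X <> Y ->
  represents u X -> represents v Y -> represents w Z ->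
  (join X Y Z <-> exists a b, w = a *: u + b *: v).
Proof.
move=> XY uX vY wZ; have [lL LX LY _] := join_spec XY.
have [e [f Lef]] := line_plane lL.
have [u1 [u2 uE]] := (Lef _ _ uX).1 LX.
have [v1 [v2 vE]] := (Lef _ _ vY).1 LY.
rewrite (Lef _ _ wZ); split=> [[w1 [w2 wE]]|[a [b wE]]]; last first.
  exists (a * u1 + b * v1), (a * u2 + b * v2).
  by rewrite wE uE vE; vect_ring.
(* A zero determinant makes u and v proportional, with coefficients v1, - u1
   and v2, - u2. *)
have [D0|Dn0] := eqVneq (u1 * v2 - u2 * v1) 0.
  have uv1 : v1 *: u + (- u1) *: v = 0.
    rewrite uE vE.
    transitivity ((- (u1 * v2 - u2 * v1)) *: f); first by vect_ring.
    by rewrite D0 oppr0 scale0r.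
  have uv2 : v2 *: u + (- u2) *: v = 0.
    rewrite uE vE.
    transitivity ((u1 * v2 - u2 * v1) *: e); first by vect_ring.
    by rewrite D0 scale0r.
  have [v10 _] := represents_colinear uX vY XY uv1.
  have [v20 _] := represents_colinear uX vY XY uv2.
  by case: (represents_neq0 vY); rewrite vE v10 v20 !scale0r addr0.
exists ((w1 * v2 - w2 * v1) / (u1 * v2 - u2 * v1)),
       ((u1 * w2 - u2 * w1) / (u1 * v2 - u2 * v1)).
apply: (scalerI Dn0).
rewrite scalerDr !scalerA ![(_ - _) * (_ / _)]mulrC !divfK //.
by rewrite wE uE vE; vect_ring.
Qed.


Lemma join_combination (u v w : hvect) X Y Z a b : X <> Y ->
  represents u X -> represents v Y -> w = a *: u + b *: v -> represents w Z ->
  join X Y Z.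
Proof. by move=> XY uX vY wE wZ; apply/(joinP XY uX vY wZ); exists a, b. Qed.

Lemma meet_eq (a b : set (epoint R)) X :
  is_line a -> is_line b -> a <> b -> a X -> b X -> meet a b = X.
Proof. by move=> la lb ab aX bX; have [_ _ /(_ X aX bX)] := meet_spec la lb ab. Qed.

Lemma joinC (X Y : epoint R) : X <> Y -> join X Y = join Y X.
Proof.
move=> XY; have [lL LX LY _] := join_spec XY.
by have [_ _ _] := join_spec (nesym XY); apply.
Qed.

(** The vector w of I is x e_i + y e_k and also z e_j + t e_s. None of x, y, z, t
    is zero, since I would then be a vertex and three vertices would be collinear.
    So the vertex vectors can be rescaled to e_i + e_k = w = e_s - e_j. *)
Lemma quadrangle_frame (A : 'I_4 -> epoint R) (i j k s : 'I_4) :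
  complete_quadrangle A -> uniq [:: i; j; k; s] ->
  let I := meet (join (A i) (A k)) (join (A j) (A s)) in
  join (A i) (A k) <> join (A j) (A s) ->
  exists ei ej ek es : hvect,
    [/\ represents ei (A i), represents ej (A j), represents ek (A k) &
        represents es (A s)] /\
    (es = ei + ej + ek /\ represents (ei + ek) I).
Proof.
move=> [Ainj Anc] ijks I ikjs.
have nc p q r : uniq [:: p; q; r] -> ~ join (A p) (A q) (A r).
  move=> pqr pqAr; have pq : A p <> A q.
    by move=> /Ainj pq; move: pqr; rewrite pq /= inE eqxx.
  by have [lL Lp Lq _] := join_spec pq; apply: (Anc _ _ _ pqr); eexists; split; eauto.
move: ijks; rewrite /= !inE !negb_or => /and4P[/and3P[ij ik is_] /andP[jk js] ks _].
have Aik : A i <> A k by move=> /Ainj /eqP; rewrite (negPf ik).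
have Ajs : A j <> A s by move=> /Ainj /eqP; rewrite (negPf js).
have [lik ikAi ikAk _] := join_spec Aik; have [ljs jsAj jsAs _] := join_spec Ajs.
have [ikI jsI _] := meet_spec lik ljs ikjs.
have ncE p q r : p != q -> p != r -> q != r -> ~ join (A p) (A q) (A r).
  by move=> pq pr qr; apply: nc; rewrite /= !inE negb_or pq pr qr.
have [[vi iE] [vj jE]] := (represents_ex (A i), represents_ex (A j)).
have [[vk kE] [vs sE]] := (represents_ex (A k), represents_ex (A s)).
have [w wI] := represents_ex I.
have [x [y wik]] := (joinP Aik iE kE wI).1 ikI.
have [z [t wjs]] := (joinP Ajs jE sE wI).1 jsI.
have only X v c : represents v X -> w = c *: v -> I = X.
  move=> vX wE; apply: (represents_inj wI); rewrite wE; apply: representsZ => //.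
  by move=> c0; apply: (represents_neq0 wI); rewrite wE c0 scale0r.
have x0 : x <> 0.
  move=> x0; have IE : I = A k by apply: (only _ _ y kE); rewrite wik x0 scale0r add0r.
  by apply: (ncE j s k) => //; [rewrite eq_sym|rewrite -IE].
have y0 : y <> 0.
  move=> y0; have IE : I = A i by apply: (only _ _ x iE); rewrite wik y0 scale0r addr0.
  by apply: (ncE j s i) => //; [rewrite eq_sym|rewrite eq_sym|rewrite -IE].
have z0 : z <> 0.
  move=> z0; have IE : I = A s by apply: (only _ _ t sE); rewrite wjs z0 scale0r add0r.
  by apply: (ncE i k s) => //; rewrite -IE.
have t0 : t <> 0.
  move=> t0; have IE : I = A j by apply: (only _ _ z jE); rewrite wjs t0 scale0r addr0.
  by apply: (ncE i k j) => //; [rewrite eq_sym|rewrite -IE].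
exists (x *: vi), (- z *: vj), (y *: vk), (t *: vs); split.
  split; apply: representsZ => //.
  by move=> /eqP; rewrite oppr_eq0 => /eqP.
rewrite -wik; split=> //.
by rewrite addrAC -wik wjs scaleNr addrC addKr.
Qed.

End HomogeneousCoordinates.

Theorem mainTheorem1 (R : realType) (A : 'I_4 -> epoint R) (i j k s : 'I_4)
    (Ujs Uik : epoint R) :
  complete_quadrangle A ->
  uniq [:: i; j; k; s] ->
  join (A j) (A s) Ujs ->
  join (A i) (A k) Uik ->
  let g := join Ujs Uik in
  let I := meet (join (A i) (A k)) (join (A j) (A s)) in
  let M := meet (join (A i) Ujs) (join (A j) (A k)) in
  let N := meet (join (A j) Uik) (join (A i) (A s)) in
  let J := meet (join (A i) M) (join (A j) N) in
  (* joined points are distinct *)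
  Ujs <> Uik ->
  A i <> Ujs -> A j <> Uik ->
  A i <> M -> A j <> N ->
  M <> N -> A s <> M -> A k <> N -> I <> J ->
  (* intersected lines are distinct *)
  join (A i) (A k) <> join (A j) (A s) ->
  join (A i) Ujs <> join (A j) (A k) ->
  join (A j) Uik <> join (A i) (A s) ->
  join (A i) M <> join (A j) N ->
  concurrent g (join M N) (join (A k) (A s)) /\
  concurrent (join (A s) M) (join (A k) N) (join I J).
Proof.
move=> quadA ijks jsU ikU g I M N J UU iU jU iM jN MN sM kN IJ ikjs iUjk jUis iMjN.
have [ei [ej [ek [es [[iE jE kE sE] [esE IE]]]]]] := quadrangle_frame quadA ijks ikjs.
rewrite -/I in IE.
have [Aij Aik Ais] : [/\ A i <> A j, A i <> A k & A i <> A s].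
  by split=> /quadA.1 e; move: ijks; rewrite /= !inE e eqxx ?orbT.
have [Ajk Ajs Aks] : [/\ A j <> A k, A j <> A s & A k <> A s].
  by split=> /quadA.1 e; move: ijks; rewrite /= !inE e eqxx ?orbT ?andbF.
have [u uE] := represents_ex Ujs; have [a [b ujs]] := (joinP Ajs jE sE uE).1 jsU.
have [v vE] := represents_ex Uik; have [c [d vik]] := (joinP Aik iE kE vE).1 ikU.
have un0 := represents_neq0 uE; have vn0 := represents_neq0 vE.
have lines X Y : X <> Y -> is_line (@join R X Y) by case/join_spec.
have Mrep : represents ((a + b) *: ej + b *: ek) M.
  have [|X XE] := @point_ex _ ((a + b) *: ej + b *: ek).
    move=> /(represents_colinear jE kE Ajk)[ab0 b0].
    by apply: un0; move: ab0; rewrite ujs b0 addr0 => ->; rewrite !scale0r addr0.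
  rewrite /M (@meet_eq _ _ _ X) //; try exact: lines.
    apply: (join_combination (a := - b) (b := 1) iU iE uE _ XE).
    by rewrite ujs esE; vect_ring.
  exact: join_combination (erefl _) XE.
have Nrep : represents (c *: ei + d *: ej + d *: ek) N.
  have nE : c *: ei + d *: ej + d *: ek = (c - d) *: ei + d *: es.
    by rewrite esE; vect_ring.
  have [|X XE] := @point_ex _ (c *: ei + d *: ej + d *: ek).
    rewrite nE => /(represents_colinear iE sE Ais)[cd0 d0].
    by apply: vn0; move: cd0; rewrite vik d0 subr0 => ->; rewrite !scale0r addr0.
  rewrite /N (@meet_eq _ _ _ X) //; try exact: lines.
    apply: (join_combination (a := d) (b := 1) jU jE vE _ XE).
    by rewrite vik; vect_ring.
  exact: (join_combination Ais iE sE nE XE).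
set m := _ + _ in Mrep; set n := _ + _ in Nrep.
have Jrep : represents ((b * c) *: ei + ((a + b) * d) *: ej + (b * d) *: ek) J.
  set w := _ + _.
  have wiM : w = (b * c) *: ei + d *: m by rewrite /w /m; vect_ring.
  have wjN : w = (a * d) *: ej + b *: n by rewrite /w /n; vect_ring.
  (* b = d = 0 would give M = A_j and N = A_i, so that A_i M and A_j N would
     be the same line. *)
  have [w0|X XE] := @point_ex _ w.
    have [_ d0] := represents_colinear iE Mrep iM (etrans (esym wiM) w0).
    have [_ b0] := represents_colinear jE Nrep jN (etrans (esym wjN) w0).
    have a0 : a <> 0 by move=> a0; apply: un0; rewrite ujs a0 b0 !scale0r addr0.
    have c0 : c <> 0 by move=> c0; apply: vn0; rewrite vik c0 d0 !scale0r addr0.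
    have MAj : M = A j.
      apply: (represents_inj Mrep); rewrite /m b0 addr0 scale0r addr0.
      exact: representsZ.
    have NAi : N = A i.
      apply: (represents_inj Nrep); rewrite /n d0 !scale0r !addr0.
      exact: representsZ.
    by case: iMjN; rewrite MAj NAi joinC.
  rewrite /J (@meet_eq _ _ _ X) //; try exact: lines.
    exact: (join_combination iM iE Mrep wiM XE).
  exact: (join_combination jN jE Nrep wjN XE).
set jv := _ + _ in Jrep.
split.
  have wMN : c *: u + a *: v = (c - d) *: m + (a + b) *: n.
    by rewrite ujs vik esE /m /n; vect_ring.
  have wks : c *: u + a *: v = (a * d - a * c) *: ek + (a * c + b * c) *: es.
    by rewrite ujs vik esE; vect_ring.
  (* c = d and a + b = 0 would make both u and v multiples of e_i + e_k,
     hence U_js = U_ik. *)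
  have [w0|X XE] := @point_ex _ (c *: u + a *: v).
    have [cd0 ab0] := represents_colinear Mrep Nrep MN (etrans (esym wMN) w0).
    have {cd0} cd : c = d by apply/eqP; rewrite -subr_eq0 cd0.
    have {ab0} ab : a = - b by apply/eqP; rewrite -addr_eq0 ab0.
    have uv0 : c *: u + (- b) *: v = 0.
      by rewrite ujs vik esE ab cd; vect_ring.
    have [c0 _] := represents_colinear uE vE UU uv0.
    by case: vn0; rewrite vik -cd c0 !scale0r addr0.
  exists X; split.
  - exact: join_combination (erefl _) XE.
  - exact: (join_combination MN Mrep Nrep wMN XE).
  - exact: (join_combination Aks kE sE wks XE).
have wkN : (c * (a + b)) *: es + (d - c) *: m
         = (a * (c - d)) *: ek + (a + b) *: n.
  by rewrite esE /m /n; vect_ring.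
have wIJ : (c * (a + b)) *: es + (d - c) *: m = (c * a) *: (ei + ek) + 1 *: jv.
  by rewrite esE /m /jv; vect_ring.
(* c = d and a + b = 0 would make the vector of J equal to bc (e_i + e_k),
   hence I = J. *)
have [w0|X XE] := @point_ex _ ((c * (a + b)) *: es + (d - c) *: m).
  have [cab0 dc0] := represents_colinear sE Mrep sM w0.
  have {dc0} dc : d = c by apply/eqP; rewrite -subr_eq0 dc0.
  have c0 : c != 0.
    by apply/eqP => c0; apply: vn0; rewrite vik dc c0 !scale0r addr0.
  move/eqP: cab0; rewrite mulf_eq0 (negPf c0) addr_eq0 => /eqP ab.
  have IJ0 : (- (b * c)) *: (ei + ek) + 1 *: jv = 0.
    by rewrite /jv ab dc; vect_ring.
  have [_ /eqP] := represents_colinear IE Jrep IJ IJ0.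
  by rewrite oner_eq0.
exists X; split.
- exact: join_combination (erefl _) XE.
- exact: (join_combination kN kE Nrep wkN XE).
- exact: (join_combination IJ IE Jrep wIJ XE).
Qed.
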